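(* Let $\gamma(t)$, $0\le t\le1$, be a smooth curve in $\mathbb R^n$ and $\{\Pi_t\}$ a smoothly varying family of affine hyperplanes such that $\gamma(t)\in\Pi_t$ and $\gamma$ is transverse to $\Pi_t$ at $\gamma(t)$, for each $t$. Let $\mathbf n_t$ be a smooth family of unit normals to $\Pi_t$, $c_t=\langle\gamma(t),\mathbf n_t\rangle$, and $\tilde\gamma(t)=(\mathbf n_t,c_t\boldsymbol\epsilon)$ the corresponding curve in $\Lambda^{n+1}$. Let $\mathbf e_t$ be a smooth section of $\{\Pi_t\}$, let $\beta(t)$ be a smooth function, and let $\tilde{\mathbf e}_t=(\mathbf e_t,\beta(t)\boldsymbol\epsilon)$, a smooth vector field along $\tilde\gamma$ tangent to $\Lambda^{n+1}$. Then $\tilde{\mathbf e}_t$ is Lorentzian parallel along $\tilde\gamma(t)$ if: (i) $\dfrac{\partial\mathbf e_t}{\partial t}=\varphi(t)\,\mathbf n_t$ for a smooth function $\varphi(t)$; and (ii) $\beta(t)=\int\varphi(t)c_t\,dt$ for each $t$ (that is, $\beta$ is an antiderivative of $\varphi(t)c_t$).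
   Context: $\Lambda^{n+1}=\{v\in\mathbb R^{n+2}:\langle v,v\rangle_L=1\}$ is de Sitter space in Minkowski space, $\langle v,w\rangle_L=\sum_{i=1}^{n+1}v_iw_i-v_{n+2}w_{n+2}$, with the induced Lorentzian metric and Levi-Civita connection. $\boldsymbol\epsilon=(1,1)$, so $(\mathbf v,c\boldsymbol\epsilon)=(\mathbf v,c,c)\in\mathbb R^{n}\times\mathbb R^2$. A smooth section $\mathbf e_t$ of $\{\Pi_t\}$ is a smooth $\mathbb R^n$-valued function of $t$ such that the vector $\mathbf e_t$ based at $\gamma(t)$ lies in $\Pi_t$, i.e. $\mathbf e_t\cdot\mathbf n_t=0$. A vector field along $\tilde\gamma$ tangent to $\Lambda^{n+1}$ is Lorentzian parallel if its covariant derivative along $\tilde\gamma$ for the Levi-Civita connection of $\Lambda^{n+1}$ vanishes. *)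

(* Defs.v *)
From HB Require Import structures.
From mathcomp Require Import all_boot all_order all_algebra.
From mathcomp Require Import all_classical all_reals all_analysis.

Set Implicit Arguments.
Unset Strict Implicit.
Unset Printing Implicit Defensive.

Import Order.TTheory GRing.Theory Num.Theory.
Import numFieldNormedType.Exports.

Local Open Scope classical_set_scope.
Local Open Scope ring_scope.

Definition iter_derive (R : numFieldType) (U V : normedModType R)
    (vs : seq U) (F : U -> V) : U -> V :=
  foldr (fun v G => 'D_v G) F vs.

(* F is C^infinity on a neighbourhood of every point of A: there, all its
   iterated directional derivatives exist and are Frechet differentiable (hence
   continuous).  A smooth map on a closed set such as [0, 1] or de Sitter space
   is thus represented by a smooth extension to a neighbourhood of that set. *)
Definition smooth_on (R : numFieldType) (U V : normedModType R)
    (A : set U) (F : U -> V) : Prop :=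
  forall x, A x -> \forall y \near x,
    forall vs : seq U, differentiable (iter_derive vs F) y.

Definition unit_interval (R : realType) : set R := `[0, 1]%classic.

Definition dot (R : realType) (n : nat) (v w : 'rV[R]_n) : R :=
  \sum_(i < n) v 0 i * w 0 i.

(* P is an affine hyperplane with unit normal v. *)
Definition unit_normal (R : realType) (n : nat)
    (P : set 'rV[R]_n) (v : 'rV[R]_n) : Prop :=
  dot v v = 1 /\ exists c : R, P = [set x | dot x v = c].

Definition direction (R : realType) (n : nat) (P : set 'rV[R]_n) :
    set 'rV[R]_n :=
  [set v | exists x y, [/\ P x, P y & v = y - x]].

Definition transverse (R : realType) (n : nat)
    (P : set 'rV[R]_n) (v : 'rV[R]_n) : Prop :=
  forall w, exists u (s : R), direction P u /\ w = u + s *: v.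

(* Minkowski space: the last of the n + 2 coordinates is the timelike one. *)
Definition lorentz (R : realType) (n : nat) (v w : 'rV[R]_(n + 2)) : R :=
  \sum_(i < n + 2) (-1) ^+ (i == n.+1 :> nat) * (v 0 i * w 0 i).

Definition de_sitter (R : realType) (n : nat) : set 'rV[R]_(n + 2) :=
  [set p | lorentz p p = 1].

(* T_p of de Sitter space, the kernel of the differential at p of
   q |-> <q, q>_L. *)
Definition tangent (R : realType) (n : nat) (p : 'rV[R]_(n + 2)) :
    set 'rV[R]_(n + 2) :=
  [set v | lorentz p v = 0].

Definition epsilon (R : realType) : 'rV[R]_2 := const_mx 1.

Definition with_epsilon (R : realType) (n : nat) (v : 'rV[R]_n) (c : R) :
    'rV[R]_(n + 2) :=
  row_mx v (c *: epsilon R).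

(* Smooth vector fields on de Sitter space.  Only the values of X on de Sitter
   space matter; outside it X is an arbitrary smooth extension. *)
Definition vector_field (R : realType) (n : nat)
    (X : 'rV[R]_(n + 2) -> 'rV[R]_(n + 2)) : Prop :=
  smooth_on (@de_sitter R n) X /\ forall p, de_sitter p -> tangent p (X p).

(* On de Sitter space this is the Lie bracket [X, Y], whatever the extensions
   of the fields X and Y. *)
Definition lie_bracket (R : realType) (n : nat)
    (X Y : 'rV[R]_(n + 2) -> 'rV[R]_(n + 2)) (p : 'rV[R]_(n + 2)) :
    'rV[R]_(n + 2) :=
  'D_(X p) Y p - 'D_(Y p) X p.

(* nabla p v Y stands for the derivative at p, along v in T_p, of the field Y. *)
Record connection (R : realType) (n : nat)
    (nabla : 'rV[R]_(n + 2) -> 'rV[R]_(n + 2) ->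
             ('rV[R]_(n + 2) -> 'rV[R]_(n + 2)) -> 'rV[R]_(n + 2)) : Prop := {
  connection_ext : forall p v Y Z, de_sitter p -> tangent p v ->
    vector_field Y -> vector_field Z ->
    (forall q, de_sitter q -> Y q = Z q) -> nabla p v Y = nabla p v Z ;
  connection_smooth : forall X Y, vector_field X -> vector_field Y ->
    exists2 Z, vector_field Z &
      forall p, de_sitter p -> Z p = nabla p (X p) Y ;
  connection_linear : forall p v w (a : R) Y, de_sitter p ->
    tangent p v -> tangent p w -> vector_field Y ->
    nabla p (a *: v + w) Y = a *: nabla p v Y + nabla p w Y ;
  connectionD : forall p v Y Z, de_sitter p -> tangent p v ->
    vector_field Y -> vector_field Z ->
    nabla p v (fun q => Y q + Z q) = nabla p v Y + nabla p v Z ;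
  connection_leibniz : forall p v (f : 'rV[R]_(n + 2) -> R) Y,
    de_sitter p -> tangent p v ->
    smooth_on (@de_sitter R n) f -> vector_field Y ->
    nabla p v (fun q => f q *: Y q) = 'D_v f p *: Y p + f p *: nabla p v Y }.

Record levi_civita (R : realType) (n : nat)
    (nabla : 'rV[R]_(n + 2) -> 'rV[R]_(n + 2) ->
             ('rV[R]_(n + 2) -> 'rV[R]_(n + 2)) -> 'rV[R]_(n + 2)) : Prop := {
  levi_civita_connection : connection nabla ;
  levi_civita_torsion_free : forall X Y p, vector_field X -> vector_field Y ->
    de_sitter p ->
    nabla p (X p) Y - nabla p (Y p) X = lie_bracket X Y p ;
  levi_civita_metric : forall p v Y Z, de_sitter p -> tangent p v ->
    vector_field Y -> vector_field Z ->
    'D_v (fun q => lorentz (Y q) (Z q)) p =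
    lorentz (nabla p v Y) (Z p) + lorentz (Y p) (nabla p v Z) }.

Definition curve (R : realType) (n : nat) (c : R -> 'rV[R]_(n + 2)) : Prop :=
  smooth_on (@unit_interval R) c /\
  forall t, unit_interval t -> de_sitter (c t).

Definition field_along (R : realType) (n : nat)
    (c V : R -> 'rV[R]_(n + 2)) : Prop :=
  smooth_on (@unit_interval R) V /\
  forall t, unit_interval t -> tangent (c t) (V t).

(* D is the covariant derivative along the curve c induced by nabla. *)
Record covariant_derivative (R : realType) (n : nat)
    (nabla : 'rV[R]_(n + 2) -> 'rV[R]_(n + 2) ->
             ('rV[R]_(n + 2) -> 'rV[R]_(n + 2)) -> 'rV[R]_(n + 2))
    (c : R -> 'rV[R]_(n + 2))
    (D : (R -> 'rV[R]_(n + 2)) -> R -> 'rV[R]_(n + 2)) : Prop := {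
  covariant_ext : forall V W, field_along c V -> field_along c W ->
    (forall t, unit_interval t -> V t = W t) ->
    forall t, unit_interval t -> D V t = D W t ;
  covariant_smooth : forall V, field_along c V ->
    exists2 W, field_along c W & forall t, unit_interval t -> W t = D V t ;
  covariantD : forall V W t, field_along c V -> field_along c W ->
    unit_interval t -> D (fun s => V s + W s) t = D V t + D W t ;
  covariant_leibniz : forall (f : R -> R) V t,
    smooth_on (@unit_interval R) f -> field_along c V -> unit_interval t ->
    D (fun s => f s *: V s) t = f^`()%classic t *: V t + f t *: D V t ;
  covariant_induced : forall Y t, vector_field Y -> unit_interval t ->
    D (fun s => Y (c s)) t = nabla (c t) (c^`()%classic t) Y }.

(* The Levi-Civita connection nabla and its covariant derivative D exist and are
   unique (as acting on vector fields), so quantifying over them amounts to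
   naming them. *)
Definition lorentzian_parallel (R : realType) (n : nat)
    (c V : R -> 'rV[R]_(n + 2)) : Prop :=
  [/\ curve c, field_along c V &
      forall nabla D, levi_civita nabla -> covariant_derivative nabla c D ->
      forall t, unit_interval t -> D V t = 0].

(* Main.v *)
Require Import Defs.
From mathcomp Require Import all_boot all_order all_algebra.
From mathcomp Require Import all_classical all_reals all_analysis.
From mathcomp Require Import ring lra.

(** In the frame [tfield a q = a - <q, a>_L q] of projected constant fields, the
Koszul argument forces the Levi-Civita connection of de Sitter space to be
[nabla_v (tfield a) = - <p, a>_L v] at [p].  Expanding a field [V] along a curve
[c] in this frame, the covariant derivative of [V] is the tangential projection
of the ordinary derivative [V'].  For the lift of [e] the conditions say that
[V' = phi c], which is normal to de Sitter space, so its projection is [0]. *)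

Set Implicit Arguments.
Unset Strict Implicit.
Unset Printing Implicit Defensive.

Import Order.TTheory GRing.Theory Num.Theory.
Import numFieldNormedType.Exports.

Local Open Scope classical_set_scope.
Local Open Scope ring_scope.

(** * Smooth maps and their iterated directional derivatives *)

Section Smooth.
Context {R : realType} {U : normedModType R}.

(** Both maps have the same first-order expansion at [x], so by uniqueness the differential of [f]
    is also that of [g]. *)
Lemma near_eq_differentiable {V W : normedModType R} (f g : V -> W) (x : V) :
  (\near x, f x = g x) -> differentiable f x -> differentiable g x.
Proof.
move=> fg df.
have gE : g \o shift x = cst (g x) + 'd f x +o_ 0 id.
  apply/eqaddoP => _/posnumP[eps].
  have /diff_locally/eqaddoP/(_ eps%:num (gt0 eps)) := df.
  move: (fg); rewrite (near_shift 0 x); apply: filterS2 => h /=.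
  rewrite subr0 => fgh.
  by rewrite !fctE /= (nbhs_singleton fg) fgh.
apply/diff_locallyP.
have -> := diff_unique (diff_continuous df) gE.
by split => //; exact: diff_continuous.
Qed.

(* Recursing on the innermost derivative lets the Leibniz rule be iterated. *)
Fixpoint diffn {W : normedModType R} (k : nat) (A : set U) (F : U -> W) : Prop :=
  (forall y, A y -> differentiable F y) /\
  if k is k'.+1 then forall v, diffn k' A ('D_v F) else True.

Lemma diffn_differentiable {W : normedModType R} k (A : set U) (F : U -> W) y :
  A y -> diffn k A F -> differentiable F y.
Proof. by move=> Ay; case: k => [|k] [+ _]; exact. Qed.

Lemma diffnW {W : normedModType R} k (A : set U) (F : U -> W) :
  diffn k.+1 A F -> diffn k A F.
Proof.
elim: k F => [|k IH] F [dF DF]; split => // v.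
by apply: IH; exact: DF.
Qed.

Lemma sub_diffn {W : normedModType R} k (A B : set U) (F : U -> W) :
  B `<=` A -> diffn k A F -> diffn k B F.
Proof.
move=> BA; elim: k F => [|k IH] F [dF DF]; split => //.
- by move=> y /BA /dF.
- by move=> y /BA /dF.
- by move=> v; exact: IH (DF v).
Qed.

Lemma eq_diffn {W : normedModType R} k (A : set U) (F G : U -> W) : open A ->
  (forall y, A y -> F y = G y) -> diffn k A F -> diffn k A G.
Proof.
move=> oA; elim: k F G => [|k IH] F G FG [dF DF].
  split=> // y Ay; apply: near_eq_differentiable (dF _ Ay).
  by near=> z; apply: FG; near: z; exact: open_nbhs_nbhs.
split=> [y Ay|v].
  apply: near_eq_differentiable (dF _ Ay).
  by near=> z; apply: FG; near: z; exact: open_nbhs_nbhs.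
apply: IH (DF v) => y Ay; apply: near_eq_derive.
by near=> z; apply: FG; near: z; exact: open_nbhs_nbhs.
Unshelve. all: by end_near. Qed.

(** [iter_derive] applies the last vector of the list first, while [diffn] peels off the innermost
    derivative; lists are therefore taken apart from their end. *)
Lemma diffnP {W : normedModType R} (A : set U) (F : U -> W) :
  (forall k, diffn k A F) <->
  (forall y, A y -> forall vs, differentiable (iter_derive vs F) y).
Proof.
split=> [dF y Ay vs|dF k].
  move: {dF}(dF (size vs)); elim/last_ind: vs F => [|vs v IH] F.
    by move=> [+ _]; exact.
  by rewrite size_rcons /iter_derive foldr_rcons => -[_ DF]; exact: IH (DF v).
elim: k F dF => [|k IH] F dF; split; try by move=> y Ay; exact: (dF y Ay [::]).
  by [].
move=> v; apply: IH => y Ay vs.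
by have := dF y Ay (rcons vs v); rewrite /iter_derive foldr_rcons.
Qed.

(** Replaces the pointwise neighbourhoods by a single open set. On an open set, equal maps have
    equal derivatives, so rules for derivatives can be iterated there. *)
Lemma smooth_onP {W : normedModType R} (A : set U) (F : U -> W) :
  smooth_on A F <->
  exists B, [/\ open B, A `<=` B & forall k, diffn k B F].
Proof.
split=> [sF|[B [oB AB dF]] x Ax].
  exists (interior
    [set y | forall vs : seq U, differentiable (iter_derive vs F) y]).
  split; first exact: open_interior.
    by move=> x /sF.
  by apply/diffnP => y /interior_subset.
have /diffnP {}dF := dF.
by near=> y; apply: dF; near: y; apply: open_nbhs_nbhs; split=> //; exact: AB.
Unshelve. all: by end_near. Qed.

Lemma diffn_cst {W : normedModType R} k (A : set U) (a : W) : diffn k A (cst a).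
Proof.
elim: k a => [|k IH] a; split=> //.
move=> v; have -> : 'D_v (cst a : U -> W) = cst 0.
  by apply/funext => y; rewrite derive_cst.
exact: IH.
Qed.

Lemma diffnD k (A : set U) (f g : U -> R) : open A ->
  diffn k A f -> diffn k A g -> diffn k A (fun y => f y + g y).
Proof.
move=> oA; elim: k f g => [|k IH] f g df dg.
  split=> // y Ay; apply: differentiableD;
    [exact: diffn_differentiable df|exact: diffn_differentiable dg].
split=> [y Ay|v].
  apply: differentiableD;
    [exact: diffn_differentiable df|exact: diffn_differentiable dg].
apply: (eq_diffn oA _ (IH _ _ (df.2 v) (dg.2 v))) => y Ay.
by rewrite deriveD //; apply: diff_derivable;
  [exact: diffn_differentiable df|exact: diffn_differentiable dg].
Qed.

Lemma diffnM k (A : set U) (f g : U -> R) : open A ->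
  diffn k A f -> diffn k A g -> diffn k A (fun y => f y * g y).
Proof.
move=> oA; elim: k f g => [|k IH] f g df dg.
  split=> // y Ay; apply: differentiableM;
    [exact: diffn_differentiable df|exact: diffn_differentiable dg].
split=> [y Ay|v].
  apply: differentiableM;
    [exact: diffn_differentiable df|exact: diffn_differentiable dg].
(* The Leibniz rule pairs a derivative of one factor, which has one order less, with the other
   factor itself; the latter is lowered to the same order. *)
have dfg := IH _ _ (diffnW df) (dg.2 v).
have dgf := IH _ _ (diffnW dg) (df.2 v).
apply: (eq_diffn oA _ (diffnD oA dfg dgf)) => y Ay.
by rewrite deriveM //; apply: diff_derivable;
  [exact: diffn_differentiable df|exact: diffn_differentiable dg].
Qed.

(** * Reduction of vector-valued maps to their coordinates *)

Lemma is_derive_rV {V : normedModType R} m (F : V -> 'rV[R]_m) x v dF :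
  is_derive x v F dF <-> forall j, is_derive x v (fun y => F y 0 j) (dF 0 j).
Proof.
split=> [[dFx <-] j|dFj].
  rewrite derive_mx // mxE; apply/derivableP.
  by move/derivable_mxP : dFx; exact.
have dFx : derivable F x v.
  by apply/derivable_mxP => i j; rewrite (ord1 i); have [] := dFj j.
apply: DeriveDef => //; rewrite derive_mx //; apply/rowP => j.
by rewrite mxE; have [_ ->] := dFj j.
Qed.

Lemma differentiable_rV {V : normedModType R} m (F : V -> 'rV[R]_m) x :
  (forall j, differentiable (fun y => F y 0 j) x) <-> differentiable F x.
Proof.
split=> dF; last first.
  move=> j; apply: (@differentiable_comp _ _ _ _ F (fun M : 'rV[R]_m => M 0 j)) => //.
  exact: differentiable_coord.
have -> : F = \sum_(j < m) (fun y => F y 0 j *: delta_mx 0 j).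
  by apply/funext => y; rewrite fct_sumE {1}(row_sum_delta (F y)).
apply: differentiable_sum => j; exact: differentiableZl.
Qed.

Lemma diffn_rV m k (A : set U) (F : U -> 'rV[R]_m) : open A ->
  (forall j, diffn k A (fun y => F y 0 j)) <-> diffn k A F.
Proof.
have coordD (G : U -> 'rV[R]_m) y v j : differentiable G y ->
    'D_v (fun z => G z 0 j) y = 'D_v G y 0 j.
  move=> dG; have /is_derive_rV/(_ j)[_ //] : is_derive y v G ('D_v G y).
  exact/derivableP/diff_derivable.
move=> oA; elim: k F => [|k IH] F.
  split=> [dF|[dF _] j]; split=> // y Ay.
    by apply/differentiable_rV => j; exact: diffn_differentiable Ay (dF j).
  by have /differentiable_rV := dF y Ay; exact.
split=> [dF|[dF DF] j].
  have dF' y : A y -> differentiable F y.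
    move=> Ay; apply/differentiable_rV => j.
    exact: diffn_differentiable Ay (dF j).
  split=> // v; apply/IH => j; apply: (eq_diffn oA _ ((dF j).2 v)) => y Ay.
  by apply: coordD; exact: dF'.
split=> [y Ay|v].
  by have /differentiable_rV := dF y Ay; exact.
have /IH/(_ j) := DF v; apply: eq_diffn => // y Ay.
by rewrite coordD //; exact: dF.
Qed.

Lemma smooth_cst {W : normedModType R} (A : set U) (a : W) :
  smooth_on A (fun=> a).
Proof.
apply/smooth_onP; exists setT; split => //; first exact: openT.
by move=> k; exact: diffn_cst.
Qed.

Lemma smooth_id (A : set U) : smooth_on A (@id U).
Proof.
apply/smooth_onP; exists setT; split => //; first exact: openT.
case=> [|k]; split=> // v.
have -> : 'D_v (@id U) = cst v by apply/funext => y; rewrite derive_id.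
exact: diffn_cst.
Qed.

Lemma smoothD (A : set U) (f g : U -> R) : smooth_on A f -> smooth_on A g ->
  smooth_on A (fun y => f y + g y).
Proof.
move=> /smooth_onP[B [oB AB df]] /smooth_onP[C [oC AC dg]].
apply/smooth_onP; exists (B `&` C); split; first exact: openI.
  by move=> x Ax; split; [exact: AB|exact: AC].
move=> k; apply: diffnD; first exact: openI.
  by apply: sub_diffn (df k) => x [].
by apply: sub_diffn (dg k) => x [].
Qed.

Lemma smoothM (A : set U) (f g : U -> R) : smooth_on A f -> smooth_on A g ->
  smooth_on A (fun y => f y * g y).
Proof.
move=> /smooth_onP[B [oB AB df]] /smooth_onP[C [oC AC dg]].
apply/smooth_onP; exists (B `&` C); split; first exact: openI.
  by move=> x Ax; split; [exact: AB|exact: AC].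
move=> k; apply: diffnM; first exact: openI.
  by apply: sub_diffn (df k) => x [].
by apply: sub_diffn (dg k) => x [].
Qed.

Lemma smooth_sum (I : Type) (r : seq I) (A : set U) (f : I -> U -> R) :
  (forall i, smooth_on A (f i)) -> smooth_on A (fun y => \sum_(i <- r) f i y).
Proof.
move=> sf; elim: r => [|i r IH].
  under eq_fun do rewrite big_nil.
  exact: smooth_cst.
under eq_fun do rewrite big_cons.
exact: smoothD.
Qed.

(** Each coordinate brings its own neighbourhood; there are finitely many, so their intersection is
    a common one. *)
Lemma smooth_rV m (A : set U) (F : U -> 'rV[R]_m) :
  (forall j, smooth_on A (fun y => F y 0 j)) <-> smooth_on A F.
Proof.
split=> [sF|/smooth_onP[B [oB AB dF]] j]; last first.
  by apply/smooth_onP; exists B; split => // k; have /diffn_rV := dF k; exact.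
pose P := [set y | forall (j : 'I_m) (vs : seq U),
  differentiable (iter_derive vs (fun z => F z 0 j)) y].
apply/smooth_onP; exists (interior P); split; first exact: open_interior.
  by move=> x Ax; apply: filter_forall => j; exact: sF.
move=> k; apply/diffn_rV; first exact: open_interior.
by move=> j; move: k; apply/diffnP => y /interior_subset Py; exact: Py.
Qed.

Lemma smooth_on_is_derive {W : normedModType R} (A : set U) (F : U -> W) (x v : U) :
  smooth_on A F -> A x -> is_derive x v F ('D_v F x).
Proof.
move=> sF Ax; apply/derivableP/diff_derivable.
exact: nbhs_singleton (sF x Ax) [::].
Qed.

End Smooth.

(** * The Lorentz form and the projected constant fields *)

Section Lorentz.
Context {R : realType} {n : nat}.
Implicit Types (u v w a b p q : 'rV[R]_(n + 2)).

Lemma lorentzC v w : lorentz v w = lorentz w v.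
Proof. by apply: eq_bigr => i _; rewrite (mulrC (v 0 i)). Qed.

Lemma lorentzPl (k : R) u v w :
  lorentz (k *: u + v) w = k * lorentz u w + lorentz v w.
Proof.
rewrite /lorentz mulr_sumr -big_split /=; apply: eq_bigr => i _.
by rewrite !mxE; ring.
Qed.

Lemma lorentz0l w : lorentz 0 w = 0.
Proof. by rewrite /lorentz big1 // => i _; rewrite mxE mul0r mulr0. Qed.

Lemma lorentzDl u v w : lorentz (u + v) w = lorentz u w + lorentz v w.
Proof. by rewrite -[u]scale1r lorentzPl mul1r scale1r. Qed.

Lemma lorentzZl (k : R) u w : lorentz (k *: u) w = k * lorentz u w.
Proof. by rewrite -[k *: u]addr0 lorentzPl lorentz0l addr0. Qed.

Lemma lorentzNl u w : lorentz (- u) w = - lorentz u w.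
Proof. by rewrite -scaleN1r lorentzZl mulN1r. Qed.

Lemma lorentzDr u v w : lorentz w (u + v) = lorentz w u + lorentz w v.
Proof. by rewrite !(lorentzC w) lorentzDl. Qed.

Lemma lorentzZr (k : R) u w : lorentz w (k *: u) = k * lorentz w u.
Proof. by rewrite !(lorentzC w) lorentzZl. Qed.

Lemma lorentzNr u w : lorentz w (- u) = - lorentz w u.
Proof. by rewrite !(lorentzC w) lorentzNl. Qed.

Lemma lorentz_sumr (I : Type) (r : seq I) (F : I -> 'rV[R]_(n + 2)) w :
  lorentz w (\sum_(i <- r) F i) = \sum_(i <- r) lorentz w (F i).
Proof.
apply: (big_morph _ (fun u v => lorentzDr u v w)).
by rewrite lorentzC lorentz0l.
Qed.

Definition lorentzE :=
  (lorentzDl, lorentzDr, lorentzNl, lorentzNr, lorentzZl, lorentzZr).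

(** Pairing with the standard basis vectors returns the coordinates of [v] up to sign. *)
Lemma lorentz_nondegenerate v : (forall a, lorentz v a = 0) -> v = 0.
Proof.
move=> v0; apply/rowP => j; rewrite mxE; have := v0 (delta_mx 0 j).
rewrite /lorentz (bigD1 j) //= big1 => [|i ij].
  rewrite addr0 mxE !eqxx mulr1 => /eqP.
  by rewrite mulf_eq0 signr_eq0 => /eqP.
by rewrite mxE (negPf ij) andbF !mulr0.
Qed.

(** The vector [epsilon] is null: its spacelike and timelike contributions [c * d] cancel. *)
Lemma lorentz_with_epsilon (v w : 'rV[R]_n) (c d : R) :
  lorentz (with_epsilon v c) (with_epsilon w d) = dot v w.
Proof.
rewrite /lorentz big_split_ord /= !big_ord_recl big_ord0 /=.
rewrite !row_mxEr !mxE /= !addn0 !addn1 (ltn_eqF (ltnSn n)) eqxx.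
rewrite expr0 expr1 mul1r mulN1r addr0 subrr addr0.
apply: eq_bigr => i _; rewrite !row_mxEl (ltn_eqF (ltnW _)) ?ltnS //.
by rewrite mul1r.
Qed.

Lemma smooth_lorentz {U : normedModType R} (A : set U)
    (F G : U -> 'rV[R]_(n + 2)) :
  smooth_on A F -> smooth_on A G ->
  smooth_on A (fun x => lorentz (F x) (G x)).
Proof.
move=> /smooth_rV sF /smooth_rV sG; apply: smooth_sum => i.
by apply: smoothM; [exact: smooth_cst|exact: smoothM].
Qed.

Lemma is_derive_lorentz {V : normedModType R} (F G : V -> 'rV[R]_(n + 2))
    (x v : V) dF dG :
  is_derive x v F dF -> is_derive x v G dG ->
  is_derive x v (fun y => lorentz (F y) (G y))
    (lorentz dF (G x) + lorentz (F x) dG).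
Proof.
move=> /is_derive_rV dFi /is_derive_rV dGi.
have -> : (fun y => lorentz (F y) (G y)) = \sum_(i < n + 2)
    ((-1) ^+ (i == n.+1 :> nat) \*: ((fun y => F y 0 i) * (fun y => G y 0 i))).
  by apply/funext => y; rewrite fct_sumE.
have := is_derive_sum (fun i => is_deriveZ ((-1) ^+ (i == n.+1 :> nat))
  (is_deriveM (dFi i) (dGi i))).
move/is_derive_eq; apply.
rewrite /lorentz -big_split /=; apply: eq_bigr => i _.
rewrite -![_ *: (_ : R)]/(_ * _); ring.
Qed.

(** On de Sitter space, where [<q, q>_L = 1], this is the orthogonal projection of [a] to the
    tangent space, that is, the gradient of the height function [<q, a>_L]. The formula is
    polynomial in [q], hence a smooth extension to the whole of Minkowski space. *)
Definition tfield a q : 'rV[R]_(n + 2) := a - lorentz q a *: q.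

Lemma lorentz_tfieldr v a p :
  lorentz p v = 0 -> lorentz v (tfield a p) = lorentz v a.
Proof. by move=> pv; rewrite /tfield !lorentzE (lorentzC v p) pv mulr0 subr0. Qed.

Lemma tangent_tfield a p : de_sitter p -> tangent p (tfield a p).
Proof.
by rewrite /de_sitter /tangent /= => p1; rewrite /tfield !lorentzE p1 mulr1 subrr.
Qed.

Lemma tfield_tangent p v : tangent p v -> tfield v p = v.
Proof. by rewrite /tangent /= /tfield => ->; rewrite scale0r subr0. Qed.

Lemma smooth_tfield {U : normedModType R} (A : set U) a
    (c : U -> 'rV[R]_(n + 2)) :
  smooth_on A c -> smooth_on A (fun x => tfield a (c x)).
Proof.
move=> sc; apply/smooth_rV => j; under eq_fun do rewrite !mxE.
apply: smoothD; first exact: smooth_cst.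
under eq_fun do rewrite -mulN1r.
apply: smoothM; first exact: smooth_cst.
apply: smoothM; last by move/smooth_rV : sc; exact.
by apply: smooth_lorentz => //; exact: smooth_cst.
Qed.

Lemma vector_field_tfield a : vector_field (tfield a).
Proof.
split; first by apply: smooth_tfield; exact: smooth_id. 
by move=> p p1; exact: tangent_tfield p1.
Qed.

(** Product rule. At a point [p] of de Sitter space the term along [p] is normal; the term along [v]
    is the value expected of the Levi-Civita connection. *)
Lemma is_derive_tfield a p v :
  is_derive p v (tfield a) (- (lorentz v a *: p + lorentz p a *: v)).
Proof.
apply/is_derive_rV => j.
have dl : is_derive p v (fun q => lorentz q a) (lorentz v a).
  have := is_derive_lorentz (is_derive_id p v) (is_derive_cst a p v).
  by move/is_derive_eq; apply; rewrite [lorentz _ 0]lorentzC lorentz0l addr0.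
have /is_derive_rV/(_ j) dj := is_derive_id p v.
have := is_deriveB (is_derive_cst (a 0 j) p v) (is_deriveM dl dj).
rewrite (_ : cst (a 0 j) - _ = fun q => tfield a q 0 j); last first.
  by apply/funext => q; rewrite !mxE.
by move/is_derive_eq; apply; rewrite !mxE -![_ *: (_ : R)]/(_ * _); ring.
Qed.

End Lorentz.

(** * The Levi-Civita connection and covariant derivatives along curves *)

Section Connection.
Context {R : realType} {n : nat}.
Implicit Types (u v w a b p q : 'rV[R]_(n + 2)).

(** Tangency is contained in the smoothness axiom, which speaks of fields; the vector [v] is
    extended to the field [tfield v], whose value at [p] is [v]. *)
Lemma connection_tangent
    (nabla : 'rV[R]_(n + 2) -> 'rV[R]_(n + 2) ->
             ('rV[R]_(n + 2) -> 'rV[R]_(n + 2)) -> 'rV[R]_(n + 2)) p v Y :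
  connection nabla -> vector_field Y -> de_sitter p -> tangent p v ->
  tangent p (nabla p v Y).
Proof.
move=> cn Yf p1 pv.
have [Z [_ tZ] /(_ p p1)] := connection_smooth cn (vector_field_tfield v) Yf.
by rewrite tfield_tangent // => <-; exact: tZ.
Qed.

(* Koszul: the defect of the formula is symmetric in two of its three arguments
   because there is no torsion, and skew in another pair because nabla is
   metric; hence it vanishes. *)
Lemma levi_civita_tfield
    (nabla : 'rV[R]_(n + 2) -> 'rV[R]_(n + 2) ->
             ('rV[R]_(n + 2) -> 'rV[R]_(n + 2)) -> 'rV[R]_(n + 2)) p v a :
  levi_civita nabla -> de_sitter p -> tangent p v ->
  nabla p v (tfield a) = - lorentz p a *: v.
Proof.
move=> lc p1 pv.
have cn := levi_civita_connection lc.
(* Directions are written [tfield u p] so that they are values of vector fields, as the torsion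
   identity requires; a tangent [v] is recovered as [tfield v p]. *)
pose G u b := nabla p (tfield u p) (tfield b) + lorentz p b *: tfield u p.
have Gtan u b : lorentz p (G u b) = 0.
  have tu := tangent_tfield u p1.
  have := connection_tangent cn (vector_field_tfield b) p1 tu.
  by move: tu; rewrite /tangent /= !lorentzE => -> ->; rewrite mulr0 addr0.
have Gsym u b : G u b = G b u.
  have := levi_civita_torsion_free lc (vector_field_tfield u)
    (vector_field_tfield b) p1.
  rewrite /lie_bracket.
  have [_ ->] := is_derive_tfield b p (tfield u p).
  have [_ ->] := is_derive_tfield u p (tfield b p).
  (* By this symmetry the normal terms of the two derivatives cancel in the Lie bracket. *)
  have -> : lorentz (tfield u p) b = lorentz (tfield b p) u.
    by rewrite /tfield !lorentzE (lorentzC b u); ring.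
  move: (lorentz (tfield b p) u) => k; rewrite /G.
  move: (nabla p (tfield u p) (tfield b)) => N1.
  move: (nabla p (tfield b p) (tfield u)) (tfield u p) (tfield b p) => N2 u' b'.
  move=> /rowP E; apply/rowP => j; move: (E j); rewrite !mxE.
  lra.
have Gskew u b d : lorentz (G u b) d + lorentz (G u d) b = 0.
  have tu := tangent_tfield u p1.
  have := levi_civita_metric lc p1 tu (vector_field_tfield b)
    (vector_field_tfield d).
  have [_ ->] := is_derive_lorentz (is_derive_tfield b p (tfield u p))
    (is_derive_tfield d p (tfield u p)).
  (* As [G] takes tangent values, [b] and [d] may be replaced by their projections, which are the
     values at [p] of the fields in the metric identity. *)
  rewrite -(lorentz_tfieldr d (Gtan u b)) -(lorentz_tfieldr b (Gtan u d)).
  have pb := tangent_tfield b p1; have pd := tangent_tfield d p1.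
  rewrite /tangent /= in tu pb pd.
  rewrite /G.
  move: (nabla p (tfield u p) (tfield b)) (nabla p (tfield u p) (tfield d)).
  move: (tfield u p) (tfield b p) (tfield d p) tu pb pd => x y z xp yp zp N1 N2.
  rewrite !lorentzE !(lorentzC y) zp yp.
  lra.
have G0 u b : G u b = 0.
  apply: lorentz_nondegenerate => d.
  (* With [T u b d = <G u b, d>_L], alternating the two rules gives [T u b d = - T u d b = - T d u b
     = T d b u = T b d u = - T b u d = - T u b d]. *)
  have := Gskew u b d; have := Gskew b d u; have := Gskew d u b.
  rewrite (Gsym b u) (Gsym d u) (Gsym d b).
  lra.
have := G0 v a; rewrite /G tfield_tangent // => /eqP.
by rewrite addr_eq0 scaleNr => /eqP.
Qed.

Lemma derive_constant_unit_interval (f : R -> R) (k : R) (t : R) :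
  unit_interval t -> derivable f t 1 ->
  (forall s, unit_interval s -> f s = k) -> 'D_1 f t = 0.
Proof.
move=> t01 df fk; have t01' := t01.
move: t01; rewrite /unit_interval /= in_itv /= => /andP[t0 t1].
(* The derivative is two-sided but [f] is known only on the interval. Since it exists, it equals a
   one-sided limit, taken from the right if [t < 1] and from the left at [t = 1]. *)
have [t_lt1|t_ge1] := ltP t 1.
  rewrite /derive cvg_at_rightE //; apply/cvg_lim => //.
  apply: cvg_near_cst; near=> h.
  rewrite /= (fk _ t01') fk ?subrr ?scaler0 //.
  rewrite /unit_interval /= in_itv /= [_%:A]mulr1; apply/andP; split.
    by rewrite addr_ge0 //; near: h; exact: nbhs_right_ge.
  rewrite -lerBrDr; near: h; apply: nbhs_right_le; lra.
rewrite /derive cvg_at_leftE //; apply/cvg_lim => //.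
apply: cvg_near_cst; near=> h.
rewrite /= (fk _ t01') fk ?subrr ?scaler0 //.
rewrite /unit_interval /= in_itv /= [_%:A]mulr1; apply/andP; split.
  rewrite -lerBlDr; near: h; apply: nbhs_left_ge; lra.
have : h <= 0 by near: h; exact: nbhs_left_le.
lra.
Unshelve. all: by end_near. Qed.

(** Differentiating [<c, c>_L = 1] gives [2 <c, c'>_L = 0], at the endpoints too. *)
Lemma curve_velocity (c : R -> 'rV[R]_(n + 2)) t :
  curve c -> unit_interval t -> tangent (c t) (c^`()%classic t).
Proof.
move=> [sc c1] t01; rewrite /tangent /= derive1E.
have dc := smooth_on_is_derive (1 : R) sc t01.
have [dl] := is_derive_lorentz dc dc.
rewrite (derive_constant_unit_interval t01 dl c1) (lorentzC ('D_1 c t)).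
lra.
Qed.

(* In the frame field of the projected coordinate vectors, whose covariant
   derivatives are known, the frame derivatives add up to a multiple of
   <c, V>_L = 0. *)
Lemma covariant_derivativeE
    (nabla : 'rV[R]_(n + 2) -> 'rV[R]_(n + 2) ->
             ('rV[R]_(n + 2) -> 'rV[R]_(n + 2)) -> 'rV[R]_(n + 2))
    (c V : R -> 'rV[R]_(n + 2)) D t :
  levi_civita nabla -> covariant_derivative nabla c D ->
  curve c -> field_along c V -> unit_interval t ->
  D V t = tfield (V^`()%classic t) (c t).
Proof.
move=> lc cd cc Vf t01; have [sc c1] := cc; have [sV cV] := Vf.
have cE a : field_along c (fun s => tfield a (c s)).
  split; first exact: smooth_tfield.
  by move=> s /c1; exact: tangent_tfield.
have sVi i : smooth_on (@unit_interval R) (fun s => V s 0 i).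
  by move/smooth_rV : sV; exact.
have cVE i : field_along c (fun s => V s 0 i *: tfield (delta_mx 0 i) (c s)).
  split.
    apply/smooth_rV => j; under eq_fun do rewrite mxE.
    by apply: smoothM => //; have [/smooth_rV + _] := cE (delta_mx 0 i); exact.
  by move=> s /c1 cs; rewrite /tangent /= lorentzE tangent_tfield // mulr0.
have cS (r : seq 'I_(n + 2)) : field_along c
    (fun s => \sum_(i <- r) V s 0 i *: tfield (delta_mx 0 i) (c s)).
  split.
    apply/smooth_rV => j; under eq_fun do rewrite summxE.
    by apply: smooth_sum => i; have [/smooth_rV + _] := cVE i; exact.
  move=> s s01; rewrite /tangent /=; elim: r => [|i r IH].
    by rewrite big_nil lorentzC lorentz0l.
  by rewrite big_cons lorentzE IH; have [_ /(_ s s01) ->] := cVE i; rewrite addr0.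
(* Projection is linear in the projected vector, so the frame expansion with the coordinates of [v]
   is the projection of [v], hence [v] itself when it is tangent. *)
have sumE (v p : 'rV[R]_(n + 2)) :
    \sum_(i < n + 2) v 0 i *: tfield (delta_mx 0 i) p = tfield v p.
  under eq_bigr do rewrite /tfield scalerBr scalerA.
  rewrite sumrB -row_sum_delta -scaler_suml /tfield; congr (_ - _ *: _).
  rewrite {2}(row_sum_delta v) lorentz_sumr; apply: eq_bigr => i _.
  by rewrite lorentzZr.
have DS (r : seq 'I_(n + 2)) :
    D (fun s => \sum_(i <- r) V s 0 i *: tfield (delta_mx 0 i) (c s)) t =
    \sum_(i <- r) (V^`()%classic t 0 i *: tfield (delta_mx 0 i) (c t)
                   - (V t 0 i * lorentz (c t) (delta_mx 0 i)) *: c^`()%classic t).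
  elim: r => [|i r IH].
    (* For the empty sum, [D 0 = 0] follows from additivity: [D 0 = D 0 + D 0]. *)
    have := covariantD cd (cS [::]) (cS [::]) t01.
    under eq_fun do rewrite big_nil addr0.
    under [X in D X t + _]eq_fun do rewrite big_nil.
    rewrite big_nil => /eqP; rewrite -subr_eq0 opprD addNKr oppr_eq0 => /eqP.
    by under eq_fun do rewrite big_nil.
  under eq_fun do rewrite big_cons.
  rewrite (covariantD cd (cVE i) (cS r) t01) big_cons IH; congr (_ + _).
  rewrite (covariant_leibniz cd (sVi i) (cE _) t01).
  rewrite (covariant_induced cd (vector_field_tfield _) t01).
  rewrite (levi_civita_tfield _ lc (c1 _ t01) (curve_velocity cc t01)).
  rewrite scalerA mulrN scaleNr; congr (_ *: _ - _).
  have /is_derive_rV/(_ i)[_] := smooth_on_is_derive (1 : R) sV t01.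
  by rewrite !derive1E => ->.
(* The expansion agrees with [V] on the unit interval, where [V] is tangent, and this determines
   [D V] there. *)
rewrite -(covariant_ext cd (cS (index_enum _)) Vf _ t01); last first.
  by move=> s /cV; rewrite sumE => /tfield_tangent.
rewrite DS sumrB sumE -scaler_suml.
(* The total coefficient of the velocity is [<c, V>_L], which vanishes by tangency. *)
have -> : \sum_i V t 0 i * lorentz (c t) (delta_mx 0 i) = 0.
  transitivity (lorentz (c t) (V t)); last exact: cV.
  rewrite [in RHS](row_sum_delta (V t)) lorentz_sumr.
  by apply: eq_bigr => i _; rewrite lorentzZr.
by rewrite scale0r subr0.
Qed.

End Connection.

(** * Lifting vectors and scalars by [with_epsilon] *)

Section WithEpsilon.
Context {R : realType} {n : nat}.

Lemma dotC (v w : 'rV[R]_n) : dot v w = dot w v.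
Proof. by apply: eq_bigr => i _; rewrite mulrC. Qed.

Lemma smooth_dot {U : normedModType R} (A : set U) (F G : U -> 'rV[R]_n) :
  smooth_on A F -> smooth_on A G -> smooth_on A (fun x => dot (F x) (G x)).
Proof.
by move=> /smooth_rV sF /smooth_rV sG; apply: smooth_sum => i; exact: smoothM.
Qed.

Lemma with_epsilonE (v : 'rV[R]_n) (c : R) j :
  with_epsilon v c 0 j =
  match fintype.split j with inl i => v 0 i | inr _ => c end.
Proof. by rewrite mxE; case: (fintype.split j) => // i; rewrite !mxE mulr1. Qed.

Lemma smooth_with_epsilon {U : normedModType R} (A : set U)
    (F : U -> 'rV[R]_n) (c : U -> R) :
  smooth_on A F -> smooth_on A c ->
  smooth_on A (fun x => with_epsilon (F x) (c x)).
Proof.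
move=> /smooth_rV sF sc; apply/smooth_rV => j.
by under eq_fun do rewrite with_epsilonE; case: (fintype.split j).
Qed.

Lemma is_derive_with_epsilon {V : normedModType R} (F : V -> 'rV[R]_n)
    (c : V -> R) (x v : V) dF dc :
  is_derive x v F dF -> is_derive x v c dc ->
  is_derive x v (fun y => with_epsilon (F y) (c y)) (with_epsilon dF dc).
Proof.
move=> /is_derive_rV dFi dc'; apply/is_derive_rV => j.
rewrite with_epsilonE; under eq_fun do rewrite with_epsilonE.
by case: (fintype.split j).
Qed.

Lemma with_epsilonZ (k : R) (v : 'rV[R]_n) (c : R) :
  with_epsilon (k *: v) (k * c) = k *: with_epsilon v c.
Proof.
apply/rowP => j; rewrite [RHS]mxE !with_epsilonE.
by case: (fintype.split j) => // i; rewrite mxE.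
Qed.

End WithEpsilon.

(** * Parallelism of the lifted section *)

Unset Implicit Arguments.

Theorem lemma6p1 (R : realType) (n : nat)
    (gamma : R -> 'rV[R]_n) (Pi : R -> set 'rV[R]_n) (nu : R -> 'rV[R]_n)
    (e : R -> 'rV[R]_n) (beta phi : R -> R)
    (gamma_smooth : smooth_on (@unit_interval R) gamma)
    (gamma_Pi : forall t, unit_interval t -> Pi t (gamma t))
    (gamma_transverse : forall t, unit_interval t ->
      transverse (Pi t) (gamma^`()%classic t))
    (nu_smooth : smooth_on (@unit_interval R) nu)
    (nu_normal : forall t, unit_interval t -> unit_normal (Pi t) (nu t))
    (e_smooth : smooth_on (@unit_interval R) e)
    (e_section : forall t, unit_interval t -> dot (e t) (nu t) = 0)
    (beta_smooth : smooth_on (@unit_interval R) beta)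
    (phi_smooth : smooth_on (@unit_interval R) phi)
    (c := fun t => dot (gamma t) (nu t))
    (e_deriv : forall t, unit_interval t -> e^`()%classic t = phi t *: nu t)
    (beta_deriv : forall t, unit_interval t -> beta^`()%classic t = phi t * c t) :
  lorentzian_parallel (fun t => with_epsilon (nu t) (c t))
                      (fun t => with_epsilon (e t) (beta t)).
Proof.
have c_smooth : smooth_on (@unit_interval R) c by exact: smooth_dot.
have V_smooth : smooth_on (@unit_interval R)
    (fun t => with_epsilon (e t) (beta t)) by exact: smooth_with_epsilon.
have nu_curve : curve (fun t => with_epsilon (nu t) (c t)).
  split; first exact: smooth_with_epsilon.
  move=> t t01; rewrite /de_sitter /= lorentz_with_epsilon.
  by have [] := nu_normal t t01.
have V_field : field_along (fun t => with_epsilon (nu t) (c t))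
    (fun t => with_epsilon (e t) (beta t)).
  split=> // t t01; rewrite /tangent /= lorentz_with_epsilon dotC.
  exact: e_section.
split=> // nabla D lc cd t t01.
rewrite (covariant_derivativeE lc cd nu_curve V_field t01) derive1E.
have [_ ->] := is_derive_with_epsilon (smooth_on_is_derive (1 : R) e_smooth t01)
  (smooth_on_is_derive (1 : R) beta_smooth t01).
(* Condition (i) gives the first component of the derivative and (ii) the second, so it is [phi t]
   times the curve point; the projection kills it because that point has Lorentz square 1. *)
rewrite -!derive1E e_deriv // beta_deriv // with_epsilonZ /tfield lorentzZr.
by rewrite (nu_curve.2 t t01) mulr1 subrr.
Qed.
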